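(* Let $\mathcal{R}$ be a mixed voting rule one of whose constituent rules is $\mathrm{MES}^{\mathrm{Null}}$, and consider any execution of $\mathcal{R}$ on an instance $I=(B,P,A,c)$ in which this constituent rule has available budget share $\alpha$. Then the outcome of $\mathcal{R}$ satisfies $\alpha$-budget EJR+ up to any project.
   Context: Instances. An instance $I=(B,P,A,c)$ consists of a budget $B\in\mathbb{R}_{>0}$, a finite set $P$ of projects, an approval profile $A=(A_1,\dots,A_n)$ of voters $N=\{1,\dots,n\}$ with $A_i\subseteq P$, and costs $c:P\to\mathbb{R}_{>0}$. Write $c(P')=\sum_{p\in P'}c(p)$ and $N_p=\{i\in N: p\in A_i\}$; it is assumed that $N_p\ne\emptyset$ for all $p\in P$. Voting rules. A voting rule $R$ takes an instance $I$, a rule budget $0<B_R\le B$, and a set $P_0\subseteq P$ of pre-selected projects with $c(P_0)\le B_R$, and outputs a set $R(I,B_R,P_0)=P^*$ with $P_0\subseteq P^*\subseteq P$ and $c(P^* )\le B_R$. Mixed rules. A mixed voting rule $\mathcal{R}=[R_1,\dots,R_m]$ takes an instance $I$, rule budgets $0<B_1\le\dots\le B_m\le B$, and a set $P_0\subseteq P$ with $c(P_0)\le B_1$. It computes $P_k=R_k(I,B_k,P_{k-1})$ for $k=1,\dots,m$, and its outcome is $P_m$. The available budget share of $R_k$ in this execution is $\alpha=(B_k-c(P_{k-1}))/B$; the set of pre-selected projects for $R_k$ is $P_{k-1}$. $\mathrm{MES}^{\mathrm{Null}}$ (Method of Equal Shares with the Null pre-allocation method). Given rule budget $B_{\mathrm{MES}}$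 and pre-selected set $P_0$, let $\alpha=(B_{\mathrm{MES}}-c(P_0))/B$ and give each voter $i$ the initial budget $b_i=\alpha B/n$. Starting from the selected set $P_0$, repeat: for each unselected project $p$ with $\sum_{i\in N_p}b_i\ge c(p)$ let $\rho(p)$ be the smallest number with $\sum_{i\in N_p}\min(b_i,\rho(p)c(p))=c(p)$; add to the selected set a project $p$ with minimum $\rho(p)$ (ties broken arbitrarily) and replace $b_i$ by $b_i-\min(b_i,\rho(p)c(p))$ for $i\in N_p$. Stop when $\sum_{i\in N_p}b_i<c(p)$ for every unselected $p$; the selected set is the outcome. Axiom. For $\beta\ge0$, a set $P^*\subseteq P$ satisfies $\beta$-budget EJR+ up to any project (for $I$) if for every nonempty $N'\subseteq N$ and every $p\in\bigcap_{i\in N'}A_i\setminus P^*$ there is $i\in N'$ with $c(A_i\cap P^* )+c(p)>\beta\frac{|N'|B}{n}$. *)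

(* Defs.v *)
From mathcomp Require Import all_boot all_order all_algebra.

Set Implicit Arguments.
Unset Strict Implicit.
Unset Printing Implicit Defensive.

Import Order.TTheory GRing.Theory Num.Theory.
Local Open Scope ring_scope.

(** The real numbers are replaced by an arbitrary [R : realFieldType].
    Voters are indexed from 0, by ['I_(nvoters I)]. *)
Record instance (R : realFieldType) : Type := Instance {
  budget : R;
  project : finType;
  nvoters : nat;
  approval : 'I_nvoters -> {set project};
  cost : project -> R;
  budget_gt0 : 0 < budget;
  cost_gt0 : forall p, 0 < cost p;
  approvers_neq0 : forall p, [set i | p \in approval i] != set0
}.

Section Definitions.
Variable R : realFieldType.

Definition voter (I : instance R) : finType := 'I_(nvoters I).

Definition approvers (I : instance R) (p : project I) : {set voter I} :=
  [set i | p \in approval i].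

Definition total_cost (I : instance R) (S : {set project I}) : R :=
  \sum_(p in S) cost p.

(** A rule is a total function; its values are constrained only on admissible
    inputs. *)
Definition valid_input (I : instance R) (BR : R) (P0 : {set project I}) : Prop :=
  0 < BR <= budget I /\ total_cost P0 <= BR.

Record voting_rule : Type := VotingRule {
  run_rule :> forall I : instance R, R -> {set project I} -> {set project I};
  run_ruleP : forall (I : instance R) (BR : R) (P0 : {set project I}),
    valid_input BR P0 ->
    P0 \subset run_rule BR P0 /\ total_cost (run_rule BR P0) <= BR
}.

Definition budget_share (I : instance R) (BR : R) (P0 : {set project I}) : R :=
  (BR - total_cost P0) / budget I.

(** [mixed_rule m] has m + 1 constituents, so that there is always at least
    one; R_(k+1) is [Rs k], with rule budget [Bs k]. *)
Definition mixed_rule (m : nat) : Type := 'I_m.+1 -> voting_rule.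

Definition valid_mixed_input (m : nat) (I : instance R) (Bs : 'I_m.+1 -> R)
    (P0 : {set project I}) : Prop :=
  [/\ 0 < Bs ord0,
      forall j k : 'I_m.+1, (j <= k)%N -> Bs j <= Bs k,
      Bs ord_max <= budget I
    & total_cost P0 <= Bs ord0].

(** [mixed_stage Rs Bs P0 k] is P_k; it is meaningful for k <= m + 1 only
    ([inord j] is the ordinal j when j <= m). The set of projects that are
    pre-selected for [Rs k] is thus [mixed_stage Rs Bs P0 k]. *)
Fixpoint mixed_stage (m : nat) (Rs : mixed_rule m) (I : instance R)
    (Bs : 'I_m.+1 -> R) (P0 : {set project I}) (k : nat) : {set project I} :=
  if k is j.+1 then
    Rs (inord j) I (Bs (inord j)) (mixed_stage Rs Bs P0 j)
  else P0.

Definition mixed_outcome (m : nat) (Rs : mixed_rule m) (I : instance R)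
    (Bs : 'I_m.+1 -> R) (P0 : {set project I}) : {set project I} :=
  mixed_stage Rs Bs P0 m.+1.

Section MES.
Variable I : instance R.
Implicit Types (S : {set project I}) (b : {ffun voter I -> R}).
Implicit Types (p q : project I) (r s : R).

Definition affordable S b p : bool :=
  (p \notin S) && (cost p <= \sum_(i in approvers p) b i).

Definition payment b p r (i : voter I) : R := Num.min (b i) (r * cost p).

Definition covers b p r : Prop :=
  \sum_(i in approvers p) payment b p r i = cost p.

Definition is_rho b p r : Prop :=
  covers b p r /\ forall s, covers b p s -> r <= s.

Definition pay b p r : {ffun voter I -> R} :=
  [ffun i => if i \in approvers p then b i - payment b p r i else b i].

(** [mes_from S b S']: from the selected set [S] and the remaining voter
    budgets [b], the method can end with the set [S'] (for some resolution
    of the ties between projects of minimum rho). *)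
Inductive mes_from : {set project I} -> {ffun voter I -> R} ->
    {set project I} -> Prop :=
| mes_stop S b : (forall p, ~~ affordable S b p) -> mes_from S b S
| mes_select S b p r S' :
    affordable S b p -> is_rho b p r ->
    (forall q s, affordable S b q -> is_rho b q s -> r <= s) ->
    mes_from (p |: S) (pay b p r) S' ->
    mes_from S b S'.

Definition null_allocation (BR : R) (P0 : {set project I}) :
    {ffun voter I -> R} :=
  [ffun=> budget_share BR P0 * budget I / (nvoters I)%:R].

Definition mes_null_outcome (BR : R) (P0 S' : {set project I}) : Prop :=
  mes_from P0 (null_allocation BR P0) S'.

End MES.

(** Since ties are broken arbitrarily, MES^Null is a family of rules, one for
    each way of breaking ties. *)
Definition is_mes_null (r : voting_rule) : Prop :=
  forall (I : instance R) (BR : R) (P0 : {set project I}),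
    valid_input BR P0 -> mes_null_outcome BR P0 (r I BR P0).

Definition budget_EJRp_any (I : instance R) (beta : R)
    (S : {set project I}) : Prop :=
  forall N' : {set voter I}, N' != set0 ->
  forall p : project I, p \in (\bigcap_(i in N') approval i) :\: S ->
  exists2 i : voter I, i \in N' &
    beta * (#|N'|%:R * budget I / (nvoters I)%:R)
      < total_cost (approval i :&: S) + cost p.

End Definitions.

(* Main.v *)
(** Fix a group N' approving an unselected project p. As long as every voter of
    N' still has c(p)/|N'| left, p is affordable with rho(p) <= 1/|N'|, so every
    project q bought meanwhile costs each of its approvers at most c(q)/|N'|.
    Since p is never bought, some i in N' eventually falls below c(p)/|N'|; at
    that moment i has spent at most c(A_i :&: P')/|N'|, where P' is the set of
    projects bought so far, and i started with alpha B/n. *)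
Require Import Defs.
From mathcomp Require Import all_boot all_order all_algebra.
From mathcomp Require Import lra.

Set Implicit Arguments.
Unset Strict Implicit.
Unset Printing Implicit Defensive.

Import Order.TTheory GRing.Theory Num.Theory.
Local Open Scope ring_scope.

(* Minimality is over all [y] that reach at least [C], rather than exactly [C],
   because removing the voter with the smallest budget from an exact solution
   only leaves an inequality. *)
Lemma least_cap_exists (R : realFieldType) (T : finType) (b : T -> R)
    (A : {set T}) (C : R) :
  A != set0 -> C <= \sum_(i in A) b i ->
  exists2 x, \sum_(i in A) Num.min (b i) x = C
    & forall y, C <= \sum_(i in A) Num.min (b i) y -> x <= y.
Proof.
move En: #|A| => n; elim: n A C En => [|n IHn] A C cardA A0 leC.
  by move/eqP: cardA; rewrite cards_eq0 (negbTE A0).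
have [i0 i0A] := set0Pn _ A0.
have [i iA bmin] : exists2 i, i \in A & forall j, j \in A -> b i <= b j.
  by case: (arg_minP b i0A) => i; exists i.
have le_cap (D : {set T}) y : \sum_(j in D) Num.min (b j) y <= y * #|D|%:R.
  rewrite mulr_natr -sumr_const; apply: ler_sum => j _.
  by rewrite ge_min lexx orbT.
have n1_gt0 : 0 < (n.+1%:R : R) by rewrite ltr0n.
(* Either the voter [i] with the smallest budget can afford an equal share of [C], and then everyone
   pays that share; or [i] pays all of [b i] and the others split [C - b i]. *)
have [leCi | ltCi] := lerP C (b i * n.+1%:R).
  exists (C / n.+1%:R) => [|y /le_trans/(_ (le_cap A y))]; last first.
    by rewrite cardA ler_pdivrMr.
  rewrite (eq_bigr (fun=> C / n.+1%:R)) => [|j jA].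
    by rewrite sumr_const cardA -[LHS]mulr_natr divfK ?gt_eqF.
  apply/min_idPr; apply: le_trans (bmin j jA).
  by rewrite ler_pdivrMr.
have cardAi : #|A :\ i| = n by move: cardA; rewrite (cardsD1 i) iA => -[].
have leCi : C - b i <= \sum_(j in A :\ i) b j.
  by rewrite lerBlDl -big_setD1.
have Ai0 : A :\ i != set0.
  apply: contraTneq ltCi => Ai0; rewrite -leNgt.
  move: leCi cardAi; rewrite Ai0 big_set0 cards0 => leCi <-.
  by rewrite mulr1 -subr_le0.
have [x xE xmin] := IHn _ _ cardAi Ai0 leCi.
(* The [n] others raise [C - b i], which exceeds [n] times [b i], with at most [x] each. Hence the
   cap [x] makes [i] pay exactly [b i]. *)
have lt_bx : b i < x.
  have n_gt0 : 0 < (n%:R : R) by rewrite ltr0n -cardAi card_gt0.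
  rewrite -(ltr_pM2r n_gt0); apply: lt_le_trans (_ : C - b i <= _).
    by move: ltCi; rewrite -natr1 mulrDr mulr1; lra.
  by rewrite -xE -cardAi; apply: le_cap.
exists x => [|y].
  by rewrite (big_setD1 i) //= xE (min_idPl (ltW lt_bx)) addrC subrK.
rewrite (big_setD1 i) //= => leCy; apply: xmin; rewrite lerBlDl.
by apply: le_trans leCy _; rewrite lerD2r ge_min lexx.
Qed.

Section Rules.
Variables (R : realFieldType) (I : instance R).
Implicit Types (S : {set project I}) (b : {ffun voter I -> R}).
Implicit Types (p q : project I) (r s : R) (N : {set voter I}).

Lemma total_cost_ge0 S : 0 <= total_cost S.
Proof. by apply: sumr_ge0 => p _; apply/ltW/cost_gt0. Qed.

Lemma total_cost_sub S S' : S \subset S' -> total_cost S <= total_cost S'.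
Proof.
move=> sub; rewrite /total_cost [leRHS](big_setID S) /= (setIidPr sub) lerDl.
exact: total_cost_ge0.
Qed.

(** A payment is capped at [r * cost p], so rho is the least cap divided by [cost p]. *)
Lemma rho_exists b p :
  cost p <= \sum_(i in approvers p) b i ->
  exists2 r, is_rho b p r
    & forall s, cost p <= \sum_(i in approvers p) payment b p s i -> r <= s.
Proof.
move=> afford; have c_gt0 := cost_gt0 p.
have [x xE xmin] := least_cap_exists (approvers_neq0 p) afford.
have rmin s :
    cost p <= \sum_(i in approvers p) payment b p s i -> x / cost p <= s.
  by move=> /xmin; rewrite ler_pdivrMr.
exists (x / cost p) => //; split=> [|s covs]; last by apply: rmin; rewrite covs.
rewrite /covers -[RHS]xE; apply: eq_bigr => i _.
by rewrite /payment divfK ?gt_eqF.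
Qed.

Lemma pay_ge0 b p r :
  (forall i, 0 <= b i) -> forall i, 0 <= pay b p r i.
Proof.
move=> b0 i; rewrite ffunE; case: ifP => // _.
by rewrite subr_ge0 ge_min lexx.
Qed.

(** At the value 1/|N| the members of [N] alone pay for [p]. Further approvers may push the sum
    above [cost p], which is why [rho_exists] compares rho with overpaying values too. *)
Lemma rho_le_invn S b p N :
  N != set0 -> N \subset approvers p -> p \notin S -> (forall i, 0 <= b i) ->
  (forall i, i \in N -> cost p <= #|N|%:R * b i) ->
  affordable S b p /\ exists2 r, is_rho b p r & r <= #|N|%:R^-1.
Proof.
move=> N0 subN pS b0 rich.
have n_gt0 : 0 < (#|N|%:R : R) by rewrite ltr0n card_gt0.
have cover : cost p <= \sum_(i in approvers p) payment b p #|N|%:R^-1 i.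
  rewrite (big_setID N) /= (setIidPr subN) -[leLHS]addr0 lerD //.
    rewrite (eq_bigr (fun=> #|N|%:R^-1 * cost p)) => [|i iN].
      by rewrite sumr_const -[leRHS]mulr_natl mulVKf ?gt_eqF.
    by apply/min_idPr; rewrite ler_pdivrMl // rich.
  apply: sumr_ge0 => i _; rewrite le_min b0 mulr_ge0 ?invr_ge0 ?ler0n //.
  exact/ltW/cost_gt0.
have afford : cost p <= \sum_(i in approvers p) b i.
  by apply: le_trans cover _; apply: ler_sum => i _; rewrite ge_min lexx.
have [r rho rmin] := rho_exists afford.
by split; [rewrite /affordable pS | exists r => //; apply: rmin].
Qed.

Lemma mes_from_sub S b S' : mes_from S b S' -> S \subset S'.
Proof.
elim=> // {}S {}b p r {}S' _ _ _ _.
by apply: subset_trans; apply: subsetUr.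
Qed.

(** Starting from an arbitrary state allows induction on the run: what a voter still holds is
    compared with the approved projects still to be bought. *)
Lemma mes_from_spending S b S' p N :
  mes_from S b S' -> (forall i, 0 <= b i) ->
  N != set0 -> N \subset approvers p -> p \notin S' ->
  exists2 i, i \in N
    & #|N|%:R * b i < total_cost (approval i :&: (S' :\: S)) + cost p.
Proof.
move=> mes + N0 subN.
(* A voter of [N] with less than c(p)/|N| left is a witness at once, so only states where all of [N]
   is rich need work. *)
have poor_or_rich b1 S1 S2 :
    (exists2 i, i \in N
      & #|N|%:R * b1 i < total_cost (approval i :&: (S2 :\: S1)) + cost p)
    \/ forall i, i \in N -> cost p <= #|N|%:R * b1 i.
  have [/existsP[i /andP[iN poor]]|] :=
    boolP [exists i, (i \in N) && (#|N|%:R * b1 i < cost p)].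
    by left; exists i => //; rewrite (lt_le_trans poor) // lerDr total_cost_ge0.
  rewrite negb_exists => /forallP rich; right=> i iN.
  by have := rich i; rewrite iN /= -leNgt.
elim: mes => {S b S'} [S b stop | S b q r S' afq rhoq rmin mesq IH] b0 pS'.
  have [//|rich] := poor_or_rich b S S.
  by have [] := rho_le_invn N0 subN pS' b0 rich; rewrite (negbTE (stop p)).
have [//|rich] := poor_or_rich b S S'.
have subqS' := mes_from_sub mesq.
have pS : p \notin S.
  by apply: contra pS' => pS; rewrite (subsetP subqS') // !inE pS orbT.
have [afp [s rhop les]] := rho_le_invn N0 subN pS b0 rich.
(* [p] competes with [q] in this round, and [q] has minimum rho. *)
have ler_ : r <= #|N|%:R^-1 := le_trans (rmin _ _ afp rhop) les.
have [i iN lti] := IH (pay_ge0 q r b0) pS'.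
exists i => //; move: lti; rewrite ffunE inE.
have n_gt0 : 0 < (#|N|%:R : R) by rewrite ltr0n card_gt0.
case: ifP => qi lti; last first.
  apply: lt_le_trans lti _; rewrite lerD2r total_cost_sub //.
  by rewrite setIS // setDS // subsetUr.
have /andP[qS _] := afq.
have qin : q \in approval i :&: (S' :\: S).
  by rewrite !inE qi qS (subsetP subqS') // !inE eqxx.
have -> : total_cost (approval i :&: (S' :\: S)) =
    cost q + total_cost (approval i :&: (S' :\: (q |: S))).
  by rewrite [q |: S]setUC -setDDl [in RHS]setIDA /total_cost (big_setD1 q).
(* Before its purchase [q] still counts as a project to be bought. This adds [cost q] to the bound,
   enough for |N| times the payment of [i]. *)
have lepay : #|N|%:R * payment b q r i <= cost q.
  rewrite -ler_pdivlMl // ge_min ler_pM2r ?ler_ ?orbT //; exact: cost_gt0.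
by move: lti; rewrite mulrBr; lra.
Qed.

Section Mixed.
Variables (m : nat) (Rs : mixed_rule R m) (Bs : 'I_m.+1 -> R).
Variable P0 : {set project I}.
Hypothesis hin : valid_mixed_input Bs P0.

(** Rules are constrained only on admissible inputs. Each output respects its own rule budget, hence
    the next, larger one. *)
Lemma valid_mixed_stage (k : 'I_m.+1) :
  valid_input (Bs k) (mixed_stage Rs Bs P0 k).
Proof.
have [B0_gt0 Bmono Bmax P0B0] := hin.
have valid_budget (j : 'I_m.+1) : 0 < Bs j <= budget I.
  rewrite (lt_le_trans B0_gt0) ?Bmono //=.
  by rewrite (le_trans _ Bmax) // Bmono // -ltnS ltn_ord.
case: k => k ltk; elim: k ltk => [|k IHk] ltk; split=> //=.
  by rewrite (le_trans P0B0) // Bmono.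
have eqk : inord k = Ordinal (ltnW ltk) by apply/val_inj; rewrite /= inordK // ltnW.
rewrite eqk; have [_ lek] := run_ruleP (Rs (Ordinal (ltnW ltk))) (IHk (ltnW ltk)).
by apply: le_trans lek _; apply: Bmono => /=.
Qed.

Lemma mixed_stage_subS (k : 'I_m.+1) :
  mixed_stage Rs Bs P0 k \subset mixed_stage Rs Bs P0 k.+1.
Proof.
by rewrite /= inord_val; have [] := run_ruleP (Rs k) (valid_mixed_stage k).
Qed.

Lemma mixed_stage_sub_outcome k :
  (k <= m.+1)%N -> mixed_stage Rs Bs P0 k \subset mixed_outcome Rs Bs P0.
Proof.
(* Induction on the number of stages left until the outcome. *)
move=> lek; rewrite -(subKn lek); elim: (m.+1 - k)%N (leq_subr k m.+1) => [|d IHd].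
  by rewrite subn0.
move=> ltd; apply: subset_trans (IHd (ltnW ltd)).
have lt1 : (m.+1 - d.+1 < m.+1)%N by rewrite ltn_subrL.
by rewrite -(subnSK ltd); apply: (mixed_stage_subS (Ordinal lt1)).
Qed.

End Mixed.
End Rules.

Theorem theorem5p1 (R : realFieldType) (m : nat) (Rs : mixed_rule R m)
    (I : instance R) (Bs : 'I_m.+1 -> R) (P0 : {set project I})
    (hin : valid_mixed_input Bs P0)
    (k : 'I_m.+1) (hmes : is_mes_null (Rs k)) :
  budget_EJRp_any (budget_share (Bs k) (mixed_stage Rs Bs P0 k))
    (mixed_outcome Rs Bs P0).
Proof.
move=> N N0 p; rewrite inE => /andP[pout /bigcapP pN].
have valid := valid_mixed_stage Rs hin k.
have stageSk : Rs k I (Bs k) (mixed_stage Rs Bs P0 k) = mixed_stage Rs Bs P0 k.+1.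
  by rewrite /= inord_val.
have subk : mixed_stage Rs Bs P0 k.+1 \subset mixed_outcome Rs Bs P0.
  exact: mixed_stage_sub_outcome.
have mes := hmes _ _ _ valid; rewrite stageSk in mes.
have alloc_ge0 i : 0 <= null_allocation (Bs k) (mixed_stage Rs Bs P0 k) i.
  have [_ leB] := valid; have B_ge0 := ltW (budget_gt0 I).
  by rewrite ffunE !mulr_ge0 ?subr_ge0 ?invr_ge0 ?ler0n.
have subN : N \subset approvers p by apply/subsetP => i /pN; rewrite inE.
have pk : p \notin mixed_stage Rs Bs P0 k.+1 by apply: contra pout; apply/subsetP.
have [i iN lti] := mes_from_spending mes alloc_ge0 N0 subN pk.
exists i => //; move: lti; rewrite ffunE !mulrA [_ * #|N|%:R]mulrC !mulrA => lti.
(* The bound counts only purchases of the MES stage; pre-selected and later projects can only raise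
   the cost. *)
apply: lt_le_trans lti _; rewrite lerD2r total_cost_sub // setIS //.
by apply: subset_trans subk; apply: subsetDl.
Qed.
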